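(* Let $d\ge2$, $X=\{0,\dots,d-1\}$ and $G\le\mathrm{Aut}(X^* )$. Then the fixed-point process of $G$ is a martingale if and only if for all $n\ge1$ and all $v\in X^{n-1}$, $H_n$ acts transitively on the set $\{vx:x\in X\}$.
   Context: $X^*$ is the rooted tree of finite words ($vx$ joined to $v$), $X^n$ the words of length $n$. $G_n$ is the image of $G$ in $\mathrm{Aut}(X^n)$ (with $G_0$ trivial), and $H_n$ is the kernel of the restriction map $G_n\to G_{n-1}$. $G_\infty=\varprojlim G_n$ with normalized Haar measure $\mu$, and $\pi_i:G_\infty\to G_i$ the projections. The fixed-point process of $G$ is the sequence of random variables $Y_i(g)=\#\{w\in X^i:\pi_i(g)(w)=w\}$ on $(G_\infty,\mu)$. It is a martingale if for all $n\ge2$ and all reals $t_1,\dots,t_{n-1}$ with $\mu(Y_1=t_1,\dots,Y_{n-1}=t_{n-1})>0$ we have $E(Y_n\mid Y_1=t_1,\dots,Y_{n-1}=t_{n-1})=t_{n-1}$.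
   Formalization: The process is taken to start at Y_0 = 1, so being a martingale also requires E(Y_1) = 1; with the condition only for n ≥ 2 the claim fails, e.g. for d = 2 and G the stabiliser of the first level, where H_1 is trivial. *)

(* Defs.v *)
From HB Require Import structures.
From mathcomp Require Import all_boot all_order all_algebra all_fingroup.
From mathcomp Require Import all_classical all_reals all_analysis.
Set Implicit Arguments.
Unset Strict Implicit.
Unset Printing Implicit Defensive.
Import Order.TTheory GRing.Theory Num.Theory.
Local Open Scope classical_set_scope.
Local Open Scope ring_scope.

Section RootedTree.
Variable d : nat.

Definition adjacent (u v : seq 'I_d) : Prop :=
  exists x, v = rcons u x \/ u = rcons v x.

Definition tree_aut (g : seq 'I_d -> seq 'I_d) : Prop :=
  [/\ bijective g, g [::] = [::]
    & forall u v, adjacent (g u) (g v) <-> adjacent u v].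

Record autSubgroup := AutSubgroup {
  aut_mem :> (seq 'I_d -> seq 'I_d) -> Prop;
  aut_memP : forall g, aut_mem g -> tree_aut g;
  aut_mem1 : aut_mem id;
  aut_memM : forall g h, aut_mem g -> aut_mem h -> aut_mem (g \o h);
  aut_memV : forall g, aut_mem g ->
    exists h, [/\ aut_mem h, cancel g h & cancel h g] }.

Definition induces n (g : seq 'I_d -> seq 'I_d) (p : {perm n.-tuple 'I_d}) :
  Prop := forall w : n.-tuple 'I_d, p w = g w :> seq 'I_d.

(* An automorphism is determined at the levels below n by its action on the
   words of length n, so Aut(X^n) is realised inside the permutations of X^n. *)
Definition level_group (G : autSubgroup) n : {set {perm n.-tuple 'I_d}} :=
  [set p | `[< exists2 g, G g & induces g p >]]%SET.

(* q is the restriction of p to the level above: p sends each child of v to a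
   child of q v. *)
Definition restricts_to n (p : {perm n.+1.-tuple 'I_d})
    (q : {perm n.-tuple 'I_d}) : bool :=
  [forall v : n.-tuple 'I_d, forall x : 'I_d,
     take n (p [tuple of rcons v x]) == q v].

(* [level_kernel G n] is H_(n+1), the kernel of G_(n+1) -> G_n. *)
Definition level_kernel (G : autSubgroup) n : {set {perm n.+1.-tuple 'I_d}} :=
  [set p in level_group G n.+1 | restricts_to p 1%g]%SET.

Definition children n (v : n.-tuple 'I_d) : {set n.+1.-tuple 'I_d} :=
  [set [tuple of rcons v x] | x : 'I_d]%SET.

Record invlim (G : autSubgroup) := InvLim {
  lproj : forall n, {perm n.-tuple 'I_d};
  lproj_in : forall n, lproj n \in level_group G n;
  lproj_compat : forall n, restricts_to (lproj n.+1) (lproj n) }.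

Section InverseLimit.
Variable G : autSubgroup.

Fact one_in n : (1%g : {perm n.-tuple 'I_d}) \in level_group G n.
Proof.
rewrite inE; apply/asboolP; exists id; first exact: aut_mem1.
by move=> w; rewrite perm1.
Qed.

Fact one_compat n :
  restricts_to (1%g : {perm n.+1.-tuple 'I_d}) (1%g : {perm n.-tuple 'I_d}).
Proof.
apply/forallP => v; apply/forallP => x; rewrite !perm1 /=.
by rewrite -cats1 take_cat size_tuple ltnn subnn take0 cats0.
Qed.

Definition invlim1 : invlim G := InvLim one_in one_compat.

HB.instance Definition _ := gen_eqMixin (invlim G).
HB.instance Definition _ := gen_choiceMixin (invlim G).
HB.instance Definition _ := isPointed.Build (invlim G) invlim1.

Fact mul_in (g h : invlim G) n : (lproj h n * lproj g n)%g \in level_group G n.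
Proof.
have := lproj_in h n; rewrite inE => /asboolW[b Gb hb].
have := lproj_in g n; rewrite inE => /asboolW[a Ga ga].
rewrite inE; apply/asboolP; exists (a \o b); first exact: aut_memM.
by move=> w; rewrite permM ga hb.
Qed.

Fact mul_compat (g h : invlim G) n :
  restricts_to (lproj h n.+1 * lproj g n.+1)%g (lproj h n * lproj g n)%g.
Proof.
apply/forallP => v; apply/forallP => x; rewrite !permM.
have /forallP/(_ v)/forallP/(_ x)/eqP hE := lproj_compat h n.
set w := lproj h n.+1 _ in hE *.
have [y wE] : exists y, w = rcons (take n w) y :> seq 'I_d.
  case/lastP: (tval w) (size_tuple w) => // s y; rewrite size_rcons => -[<-].
  by exists y; rewrite -cats1 take_size_cat // cats1.
have -> : w = [tuple of rcons (lproj h n v) y].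
  by apply: val_inj; rewrite /= wE hE.
by have /forallP/(_ (lproj h n v))/forallP/(_ y) := lproj_compat g n.
Qed.

(* Group law of composition, (g h)(w) = g (h w); the product of permutations
   p * q of the library means p first, then q. *)
Definition invlim_mul (g h : invlim G) : invlim G :=
  InvLim (mul_in g h) (mul_compat g h).

(* The inverse limit topology of the discrete groups G_n: the sets
   {h | lproj h n = lproj g n} form a neighbourhood base of g. *)
Definition invlim_open (U : set (invlim G)) : Prop :=
  forall g, U g -> exists n, forall h, lproj h n = lproj g n -> U h.

End InverseLimit.

End RootedTree.

Notation invlim_borel G := (g_sigma_algebraType (@invlim_open _ G)).

Definition is_haar (d : nat) (G : autSubgroup d) (R : realType)
    (mu : probability (invlim_borel G) R) : Prop :=
  forall (g : invlim G) (A : set (invlim_borel G)), measurable A ->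
    mu [set invlim_mul g h | h in A] = mu A.

(* The process starts at Y_0, which is the constant 1. Hence [martingale] below
   also requires E(Y_1) = 1, and conditioning on Y_0 changes nothing at the later
   steps. If the process started at Y_1, the martingale property would put no
   constraint on H_1 = G_1: for d = 2 it would hold for the stabiliser of the
   first level, where H_1 is trivial. *)
Definition fixed_point_process (d : nat) (G : autSubgroup d) (R : realType)
    (i : nat) (g : invlim_borel G) : R :=
  #|[pred w : i.-tuple 'I_d | lproj g i w == w]|%:R.

Section Martingale.
Context (disp : measure_display) (T : measurableType disp) (R : realType).
Variable P : probability T R.

(* E(Y | A) for an event A of positive probability. *)
Definition cond_expectation (A : set T) (Y : T -> R) : R :=
  (\int[P]_(x in A) Y x) / fine (P A).

(* The sequence is indexed from 0, so its first term is Y 0. *)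
Definition martingale (Y : nat -> T -> R) : Prop :=
  forall (n : nat) (t : nat -> R),
    let A := [set x | forall i, (i <= n)%N -> Y i x = t i] in
    (0 < P A)%E -> cond_expectation A (Y n.+1) = t n.

End Martingale.

(* Main.v *)
Require Import Defs.
From mathcomp Require Import all_boot all_order all_algebra all_fingroup.
From mathcomp Require Import all_classical all_reals all_analysis.
Set Implicit Arguments.
Unset Strict Implicit.
Unset Printing Implicit Defensive.
Import Order.TTheory GRing.Theory Num.Theory.

(** Haar measure is uniform on the finite quotients G_n, so conditioning on the
    history up to time n averages the number of fixed points over a union of
    cosets H_(n+1) p in G_(n+1). If H_(n+1) is transitive on the d children of
    each v, then every child vx of a vertex fixed by p is fixed by a proportion
    1/d of the coset; hence the coset average is the number of fixed points of p
    at level n. Conversely, the history Y_i = d^i for i <= n forces the identity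
    at level n, so the martingale property says that the average number of
    fixed points over H_(n+1), which by Cauchy-Frobenius is its number of orbits
    on X^(n+1), equals d^n. The d^n sets of children are stable under H_(n+1) and
    each contributes at least one orbit, hence exactly one. *)

(** * Counting in transitive actions of finite groups *)

Section TransitiveAction.
Variables (aT : finGroupType) (rT : finType) (to : {action aT &-> rT}).
Variables (G : {group aT}) (S : {set rT}).

(** The elements carrying [x] to [y] form a coset of the stabilizer of [x], whose index in [G] is
    the size of the orbit [S]. *)
Lemma card_atrans_amove x y : [transitive G, on S | to] ->
  x \in S -> y \in S -> (#|S| * #|amove to G x y| = #|G|)%N.
Proof.
move=> trG Sx Sy; have oS := atransP trG x Sx.
move: Sy; rewrite -oS => /orbitP[a Ga <-].
by rewrite amove_act ?finset.subsetT// card_rcoset card_orbit_stab.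
Qed.

Lemma card_orbits1_atrans : [acts G, on S | to] ->
  #|orbit to G @: S| = 1%N -> [transitive G, on S | to].
Proof.
move=> actS /eqP/cards1P[T orbT].
have := cover_partition (orbit_partition actS).
by rewrite orbT /finset.cover big_set1 => TS; rewrite /atrans orbT finset.in_set1 TS.
Qed.

End TransitiveAction.

(** * Action of tree automorphisms on the levels *)

Section TreeAutomorphisms.
Variable d : nat.
Implicit Types g h : seq 'I_d -> seq 'I_d.

Lemma tree_autV g h : tree_aut g -> cancel g h -> cancel h g -> tree_aut h.
Proof.
move=> [bg g0 gE] gK hK; split; first by exists g.
  by rewrite -g0 gK.
by move=> u v; rewrite -gE !hK.
Qed.

(** Adjacency is symmetric, so by itself it allows [g] to turn a child into a parent; comparing
    lengths excludes this. *)
Lemma tree_aut_rcons g : tree_aut g ->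
  forall v x, exists y, g (rcons v x) = rcons (g v) y.
Proof.
move=> ag v x.
(* Quantifying over all automorphisms makes the induction hypothesis available for the inverse of
   [g]. *)
suff size_g n g' w : tree_aut g' -> (size w <= n)%N -> size (g' w) = size w.
  have [_ _ gE] := ag.
  have [y [gv|gv]] := (gE v (rcons v x)).2 (ex_intro _ x (or_introl erefl)).
    by exists y.
  have := congr1 size gv; rewrite size_rcons !(size_g _ _ _ ag (leqnn _)).
  by rewrite size_rcons => /eqP; rewrite -[X in X == _]addn0 -addn2 eqn_add2l.
elim: n g' w {g ag v x} => [|n IHn] g w ag.
  by rewrite leqn0 => /nilP->; case: ag => _ ->.
case/lastP: w => [_|v x]; first by case: ag => _ ->.
rewrite size_rcons ltnS => le_vn; have [[h gK hK] _ gE] := ag.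
have [y [->|gv]] := (gE v (rcons v x)).2 (ex_intro _ x (or_introl erefl)).
  by rewrite size_rcons (IHn g).
have sgv := IHn g v ag le_vn.
(* If [g (rcons v x)] is the parent of [g v], it is short enough for the induction hypothesis on
   [h]; the length of [v] then exceeds itself by 2. *)
have le_gw : (size (g (rcons v x)) <= n)%N.
  by rewrite (leq_trans _ le_vn)// -sgv gv size_rcons.
have := IHn h _ (tree_autV ag gK hK) le_gw; rewrite gK size_rcons => sz.
move: sgv; rewrite gv size_rcons -sz => /eqP.
by rewrite -[X in _ == X]addn0 -addn2 eqn_add2l.
Qed.

Lemma tree_aut_size g : tree_aut g -> forall w, size (g w) = size w.
Proof.
move=> ag; elim/last_ind => [|v x IHv]; first by case: ag => _ ->.
by have [y ->] := tree_aut_rcons ag v x; rewrite !size_rcons IHv.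
Qed.

Lemma level_perm_proof g (ag : tree_aut g) n (w : n.-tuple 'I_d) :
  size (g w) == n.
Proof. by rewrite tree_aut_size ?size_tuple. Qed.

Lemma level_perm_inj g (ag : tree_aut g) n :
  injective (fun w : n.-tuple 'I_d => Tuple (level_perm_proof ag w)).
Proof.
move=> u v /(congr1 val) /= guv; apply: val_inj.
by have [/bij_inj/(_ _ _ guv)] := ag.
Qed.

Definition level_perm g (ag : tree_aut g) n : {perm n.-tuple 'I_d} :=
  perm (@level_perm_inj g ag n).

Lemma level_permE g (ag : tree_aut g) n w : level_perm ag n w = g w :> seq _.
Proof. by rewrite permE. Qed.

Lemma parent_proof n (w : n.+1.-tuple 'I_d) : size (take n w) == n.
Proof. by rewrite size_takel // size_tuple. Qed.

Definition parent n (w : n.+1.-tuple 'I_d) : n.-tuple 'I_d :=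
  Tuple (parent_proof w).

Lemma parent_rcons n (v : n.-tuple 'I_d) x :
  parent [tuple of rcons v x] = v.
Proof.
by apply: val_inj; rewrite /= -cats1 take_size_cat ?size_tuple.
Qed.

Lemma tuple_rconsP n (w : n.+1.-tuple 'I_d) :
  exists x, w = [tuple of rcons (parent w) x].
Proof.
have [x wE] : exists x, w = rcons (take n w) x :> seq 'I_d.
  case/lastP: (tval w) (size_tuple w) => // s y; rewrite size_rcons => -[<-].
  by exists y; rewrite -cats1 take_size_cat // cats1.
by exists x; apply: val_inj.
Qed.

Lemma in_children n (v : n.-tuple 'I_d) w :
  (w \in children v) = (parent w == v).
Proof.
apply/imsetP/eqP => [[x _ ->]|<-]; first exact: parent_rcons.
by have [x {1}->] := tuple_rconsP w; exists x.
Qed.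

Lemma card_children n (v : n.-tuple 'I_d) : #|children v| = d.
Proof.
rewrite card_imset ?card_ord // => x y /(congr1 val) /=.
by move/eqP; rewrite eqseq_rcons => /andP[_ /eqP].
Qed.

Lemma restricts_toP n (p : {perm n.+1.-tuple 'I_d}) (q : {perm n.-tuple 'I_d}) :
  reflect (forall w, parent (p w) = q (parent w)) (restricts_to p q).
Proof.
apply: (iffP forallP) => [pq w|pq v].
  have [x {1}->] := tuple_rconsP w; apply: val_inj => /=.
  by have /forallP/(_ x)/eqP := pq (parent w).
by apply/forallP => x; rewrite -[take _ _]/(val (parent _)) pq parent_rcons.
Qed.

Lemma parent_surj (d_gt0 : (0 < d)%N) n (v : n.-tuple 'I_d) :
  exists w, parent w = v.
Proof. by exists [tuple of rcons v (Ordinal d_gt0)]; exact: parent_rcons. Qed.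

Lemma restricts_to_inj (d_gt0 : (0 < d)%N) n (p : {perm n.+1.-tuple 'I_d}) q q' :
  restricts_to p q -> restricts_to p q' -> q = q'.
Proof.
move=> /restricts_toP pq /restricts_toP pq'; apply/permP => v.
by have [w <-] := parent_surj d_gt0 v; rewrite -pq pq'.
Qed.

Lemma level_perm_compat g (ag : tree_aut g) n :
  restricts_to (level_perm ag n.+1) (level_perm ag n).
Proof.
apply/restricts_toP => w; have [x ->] := tuple_rconsP w.
apply: val_inj; rewrite parent_rcons /= !level_permE /=.
have [y ->] := tree_aut_rcons ag (parent w) x.
by rewrite -cats1 take_size_cat // tree_aut_size // size_tuple.
Qed.

End TreeAutomorphisms.

(** * Orbits and fixed points of H_(n+1) and its cosets *)

Section LevelKernel.
Variables (d : nat) (G : autSubgroup d).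

Definition fix_card n (p : {perm n.-tuple 'I_d}) : nat := #|[pred w | p w == w]|.

Lemma level_groupM n (p q : {perm n.-tuple 'I_d}) :
  p \in level_group G n -> q \in level_group G n ->
  (p * q)%g \in level_group G n.
Proof.
rewrite !finset.inE => /asboolP[a Ga pa] /asboolP[b Gb qb]; apply/asboolP.
by exists (b \o a); [exact: aut_memM | move=> w; rewrite permM qb pa].
Qed.

Lemma level_kernelP n (p : {perm n.+1.-tuple 'I_d}) :
  reflect (p \in level_group G n.+1 /\ forall w, parent (p w) = parent w)
          (p \in level_kernel G n).
Proof.
rewrite [_ \in level_kernel _ _]inE; apply: (iffP andP) => -[Gp Hp]; split=> //.
  by move=> w; rewrite (restricts_toP _ _ Hp) perm1.
by apply/restricts_toP => w; rewrite perm1.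
Qed.

Lemma level_kernel_group_set n : group_set (level_kernel G n).
Proof.
apply/group_setP; split.
  by apply/level_kernelP; split=> [|w]; [exact: one_in | rewrite perm1].
move=> p q /level_kernelP[Gp Hp] /level_kernelP[Gq Hq].
apply/level_kernelP; split; first exact: level_groupM.
by move=> w; rewrite permM Hq.
Qed.

Canonical level_kernel_group n := Group (level_kernel_group_set n).

Lemma level_kernel_acts n (v : n.-tuple 'I_d) :
  [acts level_kernel G n, on children v | 'P].
Proof.
apply/actsP => p /level_kernelP[_ Hp] w.
by rewrite !in_children /= apermE Hp.
Qed.

(** Splitting along parents prepares for Cauchy-Frobenius on each set of children separately. *)
Lemma fix_card_parent n (p : {perm n.+1.-tuple 'I_d}) :
  fix_card p = (\sum_v #|'Fix_(children v | 'P)[p]%g|)%N.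
Proof.
rewrite /fix_card -sum1_card (partition_big (@parent d n) predT) //=.
apply: eq_bigr => v _; rewrite -sum1_card; apply: eq_bigl => w.
by rewrite !finset.inE in_children finset.sub1set !finset.inE /= apermE andbC.
Qed.

Lemma level_kernel_atrans (d_gt0 : (0 < d)%N) n :
  (\sum_(h in level_kernel G n) fix_card h = d ^ n * #|level_kernel G n|)%N ->
  forall v : n.-tuple 'I_d, [transitive level_kernel G n, on children v | 'P].
Proof.
under eq_bigr do rewrite fix_card_parent.
rewrite exchange_big /=.
under eq_bigr do rewrite Frobenius_Cauchy ?level_kernel_acts //.
rewrite -big_distrl /= => /eqP; rewrite eqn_pmul2r ?cardG_gt0 //.
rewrite -[d in (d ^ n)%N]card_ord -card_tuple -sum1_card eq_sym.
(* The left side is now a sum of ones over the vertices of level [n]. Recording the equality case of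
   the termwise bound lets equality of the sums force exactly one orbit at each [v]. *)
have orb_gt0 (v : n.-tuple 'I_d) :
    (1 <= #|orbit 'P (level_kernel G n) @: children v| ?=
      iff (#|orbit 'P (level_kernel G n) @: children v| == 1))%N.
  split; last by rewrite eq_sym.
  rewrite card_gt0; apply/set0Pn.
  have [w wv] := parent_surj d_gt0 v.
  exists (orbit 'P (level_kernel G n) w); apply: imset_f.
  by rewrite in_children wv.
rewrite (leqif_sum (fun v _ => orb_gt0 v)).2 => /forallP orb1 v.
apply: card_orbits1_atrans; first exact: level_kernel_acts.
exact/eqP/(orb1 v).
Qed.

(** Double counting of the pairs ([h], [w]) with [h * p] fixing [w]: a vertex fixed by [q]
    contributes the order of the kernel through its [d] children, any other vertex nothing. *)
Lemma sum_fix_card_coset (d_gt0 : (0 < d)%N) n (p : {perm n.+1.-tuple 'I_d}) q :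
  (forall v : n.-tuple 'I_d,
    [transitive level_kernel G n, on children v | 'P]) ->
  restricts_to p q ->
  (\sum_(h in level_kernel G n) fix_card (h * p)%g
    = fix_card q * #|level_kernel G n|)%N.
Proof.
(* Multiplying by [d] clears the proportion 1/d. *)
move=> trH /restricts_toP pq; apply/eqP; rewrite -(eqn_pmul2l d_gt0); apply/eqP.
(* The product applies [h] first, so [h * p] fixes [w] exactly when [h] carries [w] to its preimage
   under [p]. *)
have -> : (\sum_(h in level_kernel G n) fix_card (h * p)%g =
    \sum_(w : n.+1.-tuple 'I_d)
      #|amove 'P (level_kernel G n) w ((p^-1)%g w)|)%N.
  rewrite /fix_card; under eq_bigr do rewrite -sum1_card big_mkcond /=.
  rewrite exchange_big /=; apply: eq_bigr => w _.
  rewrite -big_mkcondr -sum1_card; apply: eq_bigl => h.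
  by rewrite !finset.inE permM /= apermE (can2_eq (permK p) (permKV p)).
rewrite big_distrr (partition_big (@parent d n) predT) //=.
rewrite /fix_card -sum1_card big_distrl big_distrr [RHS]big_mkcond /=.
apply: eq_bigr => v _; rewrite mul1n.
case: ifPn => [/eqP qv|/eqP qv].
  rewrite -[X in _ = (X * _)%N](card_children v) -sum1_card.
  rewrite big_distrl /=.
  apply: eq_big => [w|w vw]; first by rewrite in_children.
  rewrite mul1n -[X in (X * _)%N](card_children v).
  apply: card_atrans_amove => //; rewrite in_children ?vw //.
  (* The preimage of [w] under [p] is also a child of [v], because [q] sends both its parent and [v]
     to [v]. *)
  apply/eqP/(@perm_inj _ q); rewrite -pq permKV qv; exact/eqP.
(* Kernel elements keep parents, so one that moves [w] to its preimage under [p] would force [q] to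
   fix [v]. *)
rewrite big1 // => w /eqP wv; apply/eqP; rewrite muln_eq0 finset.cards_eq0.
apply/orP; right; apply/eqP/setP => h; rewrite finset.in_set0 finset.inE.
apply/negP => /andP[/level_kernelP[_ Hh] /eqP]; rewrite /= apermE => hw.
by apply: qv; rewrite -wv -{1}Hh -pq hw permKV.
Qed.

End LevelKernel.

(** * The inverse limit and its finite levels *)

Section InverseLimit.
Local Open Scope classical_set_scope.
Local Open Scope ring_scope.
Variables (d : nat) (d_gt0 : (0 < d)%N) (G : autSubgroup d).

Lemma invlim_eq (g h : invlim G) : (forall n, lproj g n = lproj h n) -> g = h.
Proof.
case: g h => [g g1 g2] [h h1 h2] /= gh.
have {}gh := functional_extensionality_dep gh.
by case: _ / gh in h1 h2 *; congr InvLim; exact: Prop_irrelevance.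
Qed.

Lemma level_perm_in a (Ga : G a) n :
  level_perm (aut_memP Ga) n \in level_group G n.
Proof.
by rewrite finset.inE; apply/asboolP; exists a => // w; exact: level_permE.
Qed.

Definition invlim_of a (Ga : G a) : invlim G :=
  InvLim (level_perm_in Ga) (level_perm_compat (aut_memP Ga)).

(** An element of [G] inducing [p] gives [g], and its inverse in [G] gives [g']. The second clause
    makes left translation by [g] surjective, as needed for translates of cylinders. *)
Lemma lproj_surj n p : p \in level_group G n ->
  exists g g' : invlim G, lproj g n = p /\
    forall h, invlim_mul g (invlim_mul g' h) = h.
Proof.
rewrite finset.inE => /asboolP[a Ga pa]; have [b [Gb aK bK]] := aut_memV Ga.
exists (invlim_of Ga), (invlim_of Gb); split.
  by apply/permP => w; apply: val_inj; rewrite /= level_permE pa.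
move=> h; apply: invlim_eq => m; rewrite /= -mulgA.
have -> : (level_perm (aut_memP Gb) m * level_perm (aut_memP Ga) m = 1)%g.
  by apply/permP => w; apply: val_inj; rewrite permM perm1 /= !level_permE bK.
exact: mulg1.
Qed.

Lemma lproj_eq_le n (g h : invlim G) : lproj g n = lproj h n ->
  forall i, (i <= n)%N -> lproj g i = lproj h i.
Proof.
elim: n => [|n IHn] ghn i; first by rewrite leqn0 => /eqP->.
rewrite leq_eqVlt => /predU1P[->//|]; rewrite ltnS; apply: IHn.
apply: (restricts_to_inj d_gt0 (lproj_compat g n)).
by rewrite ghn; exact: lproj_compat.
Qed.

(** These are the preimages of subsets of G_n, that is, the events decided at level [n]. *)
Definition saturated n (A : set (invlim G)) :=
  forall g h : invlim G, lproj g n = lproj h n -> A g -> A h.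

Definition lproj_image n (A : set (invlim G)) : {set {perm n.-tuple 'I_d}} :=
  [set p | `[< exists2 g, A g & lproj g n = p >]]%SET.

Lemma lproj_imageP n A p :
  reflect (exists2 g, A g & lproj g n = p) (p \in lproj_image n A).
Proof. by rewrite finset.inE; exact: asboolP. Qed.

Lemma saturatedS n A : saturated n A -> saturated n.+1 A.
Proof. by move=> sA g h gh; apply: sA; exact: lproj_eq_le gh _ (leqnSn n). Qed.

(** Multiplying by a kernel element leaves the restriction to level [n] unchanged, so a lift of
    [h * p] stays in [A]. *)
Lemma lproj_imageM n A h p : saturated n A -> h \in level_kernel G n ->
  p \in lproj_image n.+1 A -> (h * p)%g \in lproj_image n.+1 A.
Proof.
move=> sA /level_kernelP[Gh Hh] /lproj_imageP[g Ag gp].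
have [|g' [_ [g'hp _]]] := @lproj_surj n.+1 (h * p)%g.
  by apply: level_groupM => //; rewrite -gp lproj_in.
apply/lproj_imageP; exists g' => //; apply: sA Ag.
apply: (@restricts_to_inj _ d_gt0 _ (lproj g' n.+1)); last exact: lproj_compat.
apply/restricts_toP => w; rewrite g'hp permM -gp.
by rewrite (restricts_toP _ _ (lproj_compat g n)) Hh.
Qed.

End InverseLimit.

(** * Haar measure as uniform measure on each level *)

Section HaarMeasure.
Local Open Scope classical_set_scope.
Local Open Scope ring_scope.
Variables (R : realType) (d : nat) (d_gt0 : (0 < d)%N) (G : autSubgroup d).
Variables (mu : probability (invlim_borel G) R) (hmu : is_haar mu).

Definition cylinder n (p : {perm n.-tuple 'I_d}) : set (invlim_borel G) :=
  [set g | lproj (g : invlim G) n = p].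

Lemma measurable_saturated n (A : set (invlim_borel G)) :
  saturated n A -> measurable A.
Proof.
move=> sA; apply: sub_sigma_algebra => g Ag.
by exists n => h /esym gh; apply: sA Ag.
Qed.

Lemma saturated_cylinder n (p : {perm n.-tuple 'I_d}) :
  saturated n (cylinder p).
Proof. by move=> g h gh <-. Qed.

Lemma measurable_cylinder n (p : {perm n.-tuple 'I_d}) :
  measurable (cylinder p).
Proof. exact: measurable_saturated (@saturated_cylinder n p). Qed.

(** Left translation by a point over [p] carries the cylinder of the identity onto that of [p]. *)
Lemma haar_cylinder n p : p \in level_group G n ->
  mu (cylinder p) = mu (cylinder (1%g : {perm n.-tuple 'I_d})).
Proof.
move=> /lproj_surj[g [g' [gp gK]]]; rewrite -(hmu g (measurable_cylinder 1%g)).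
congr (mu _); apply/seteqP; split=> [h hp|_ [h h1 <-]].
  exists (invlim_mul g' h); last exact: gK.
  have /(congr1 (fun x => lproj x n)) /= := gK h.
  rewrite /cylinder /= in hp *; rewrite hp gp => pE.
  by apply: (mulIg p); rewrite pE mul1g.
by rewrite /cylinder /= in h1 *; rewrite h1 mul1g.
Qed.

Lemma saturated_bigsetU n (A : set (invlim_borel G)) : saturated n A ->
  A = \big[setU/set0]_(p <- enum (lproj_image n A)) cylinder p.
Proof.
move=> sA; rewrite -bigcup_seq; apply/seteqP; split=> [g Ag|g [p]].
  exists (lproj (g : invlim G) n) => //=.
  by rewrite mem_enum; apply/lproj_imageP; exists g.
rewrite /= mem_enum => /lproj_imageP[h Ah hp] gp.
by apply: (sA h g) => //; rewrite hp.
Qed.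

Lemma trivIset_cylinder n (D : set {perm n.-tuple 'I_d}) :
  trivIset D (@cylinder n).
Proof. by move=> p q _ _ [g [<- <-]]. Qed.

(** The integrand is constant on each of the finitely many disjoint cylinders that make up [A], and
    these have equal mass. *)
Lemma integral_saturated n (A : set (invlim_borel G))
    (F : {perm n.-tuple 'I_d} -> R) : saturated n A ->
  \int[mu]_(g in A) F (lproj (g : invlim G) n) =
    fine (mu (cylinder (1%g : {perm n.-tuple 'I_d}))) *
    \sum_(p in lproj_image n A) F p.
Proof.
move=> sA; rewrite /Rintegral {1}(saturated_bigsetU sA).
rewrite integral_bigsetU_EFin; last 4 first.
- exact: measurable_cylinder.
- exact: enum_uniq.
- exact: trivIset_cylinder.
(* The integrand factors through level [n], so its preimages are again saturated. *)
- move=> _ Y _; apply: measurableI.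
    by rewrite -saturated_bigsetU//; exact: measurable_saturated sA.
  by apply: (@measurable_saturated n) => g h /= ->.
rewrite big_enum /= mulr_sumr.
transitivity (fine (\sum_(p in lproj_image n A)
  (fine (mu (cylinder (1%g : {perm n.-tuple 'I_d}))) * F p)%:E)%E); last first.
  by rewrite sumEFin.
congr fine; apply: eq_bigr => p /lproj_imageP[g Ag gp].
rewrite (eq_integral (fun=> (F p)%:E)); last first.
  by move=> h; rewrite inE /cylinder /= => ->.
have Gp : p \in level_group G n by rewrite -gp lproj_in.
have mp := @measurable_cylinder n p.
by rewrite integral_cst// EFinM muleC -(haar_cylinder Gp) fineK ?fin_num_measure.
Qed.

Lemma haar_saturated n (A : set (invlim_borel G)) : saturated n A ->
  fine (mu A) =
    fine (mu (cylinder (1%g : {perm n.-tuple 'I_d}))) * #|lproj_image n A|%:R.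
Proof.
move=> sA; have := integral_saturated (fun=> 1) sA.
rewrite sumr_const => <-; rewrite Rintegral_cst ?mul1r//.
exact: measurable_saturated sA.
Qed.

(** The total mass 1 is a multiple of the mass of one cylinder. *)
Lemma haar_cylinder_neq0 n :
  fine (mu (cylinder (1%g : {perm n.-tuple 'I_d}))) != 0.
Proof.
have := @haar_saturated n setT (fun _ _ _ _ => I).
rewrite probability_setT /= => /esym/eqP; apply: contraTneq => ->.
by rewrite mul0r eq_sym oner_eq0.
Qed.

Lemma haar_gt0 n (A : set (invlim_borel G)) : saturated n A ->
  (0 < mu A)%E = (0 < #|lproj_image n A|)%N.
Proof.
move=> sA; rewrite lt0e measure_ge0 andbT lt0n.
rewrite -fine_eq0; last first.
  by apply: fin_num_measure; exact: measurable_saturated sA.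
by rewrite (haar_saturated sA) mulf_eq0 (negPf (haar_cylinder_neq0 n)) pnatr_eq0.
Qed.

Lemma cond_expectation_saturated n (A : set (invlim_borel G))
    (F : {perm n.-tuple 'I_d} -> R) : saturated n A ->
  cond_expectation mu A (fun g => F (lproj (g : invlim G) n)) =
    (\sum_(p in lproj_image n A) F p) / #|lproj_image n A|%:R.
Proof.
move=> sA; rewrite /cond_expectation integral_saturated// (haar_saturated sA).
by rewrite -mulf_div divff ?haar_cylinder_neq0// mul1r.
Qed.

End HaarMeasure.

(** * The martingale property and transitivity *)

Section Martingale.
Local Open Scope classical_set_scope.
Local Open Scope ring_scope.
Variables (R : realType) (d : nat) (d_gt0 : (0 < d)%N) (G : autSubgroup d).
Variables (mu : probability (invlim_borel G) R) (hmu : is_haar mu).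

(** The image of [A] at level [n.+1] is stable under H_(n+1), so the sum over it is the average of
    its translates by the kernel; exchanging the sums leaves sums over cosets. *)
Lemma sum_fix_card_saturated n (A : set (invlim G)) (t : R) :
  (forall v : n.-tuple 'I_d,
    [transitive level_kernel G n, on children v | 'P]) ->
  saturated n A -> (forall g, A g -> (fix_card (lproj g n))%:R = t) ->
  \sum_(p in lproj_image n.+1 A) (fix_card p)%:R = t * #|lproj_image n.+1 A|%:R.
Proof.
move=> trH sA At; set B := lproj_image n.+1 A.
have H_neq0 : #|level_kernel G n|%:R != 0 :> R.
  by rewrite pnatr_eq0 -lt0n (cardG_gt0 (level_kernel_group G n)).
apply: (mulIf H_neq0).
transitivity (\sum_(h in level_kernel G n) \sum_(p in B)
    (fix_card (h * p)%g)%:R : R).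
  rewrite mulr_natr -sumr_const; apply: eq_bigr => h Hh.
  rewrite (reindex_inj (mulgI h)) /=; apply: eq_bigl => p.
  apply/idP/idP => [Bhp|]; last exact: lproj_imageM.
  rewrite -[p](mulKg h); apply: lproj_imageM => //.
  exact: (@groupVr _ (level_kernel_group G n)).
rewrite exchange_big /= -mulrA mulrCA mulr_natl -sumr_const.
apply: eq_bigr => p /lproj_imageP[g Ag gp].
rewrite -natr_sum (@sum_fix_card_coset _ _ d_gt0 _ _ (lproj g n))//.
  by rewrite natrM At.
by rewrite -gp lproj_compat.
Qed.

Lemma fix_card1 n (p : {perm n.-tuple 'I_d}) :
  (fix_card p == d ^ n)%N = (p == 1%g).
Proof.
apply/eqP/eqP => [|->]; last first.
  rewrite -[d in RHS]card_ord -card_tuple; apply: eq_card => w.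
  by rewrite !inE perm1 eqxx.
rewrite -[d in (d ^ n)%N]card_ord -card_tuple => fixp.
apply/permP => w; rewrite perm1.
suff : w \in [pred w | p w == w] by rewrite inE => /eqP.
have /subset_cardP sub : #|[pred w | p w == w]| = #|{: n.-tuple 'I_d}| by [].
by rewrite (elimT sub)//; apply/fintype.subsetP.
Qed.

(** Every kernel element lifts to the limit, and its lifts are trivial at level [n]. *)
Lemma lproj_image_kernel n (A : set (invlim G)) :
  (forall g, A g <-> lproj g n = 1%g) ->
  lproj_image n.+1 A = level_kernel G n.
Proof.
move=> AE; apply/setP => p; rewrite [RHS]finset.inE.
apply/lproj_imageP/andP => [[g /AE g1 <-]|[Gp p1]].
  by rewrite lproj_in -g1 lproj_compat.
have [g [_ [gp _]]] := lproj_surj Gp; exists g => //; apply/AE.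
by apply: (restricts_to_inj d_gt0 (lproj_compat g n)); rewrite gp.
Qed.

Lemma saturated_history n (t : nat -> R) : saturated n
  [set g : invlim G | forall i, (i <= n)%N -> fixed_point_process R i g = t i].
Proof.
move=> g h gh Ag i le_in; rewrite -Ag// /fixed_point_process.
by rewrite (lproj_eq_le d_gt0 gh).
Qed.

(** The event is decided at level [n] but the variable lives at level [n.+1], so the average is
    taken one level up. *)
Lemma cond_expectation_history n (A : set (invlim_borel G)) : saturated n A ->
  cond_expectation mu A (fixed_point_process R n.+1) =
    (\sum_(p in lproj_image n.+1 A) (fix_card p)%:R) /
    #|lproj_image n.+1 A|%:R.
Proof.
by move=> /(saturatedS d_gt0)/(cond_expectation_saturated hmu) <-.
Qed.

Lemma martingale_atrans : martingale mu (fixed_point_process (G := G) R) ->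
  forall n (v : n.-tuple 'I_d),
    [transitive level_kernel G n, on children v | 'P].
Proof.
move=> mY n; apply: level_kernel_atrans => //.
(* The values [d ^ i] single out the points trivial at level [n]. One level up their image is
   H_(n+1), which contains the identity, so the event has positive measure. *)
have /= := mY n (fun i => (d ^ i)%:R); set A := (X in (0%R < mu X)%E).
have sA : saturated n A by exact: saturated_history.
have AE (g : invlim G) : A g <-> lproj g n = 1%g.
  split=> [/(_ n (leqnn n))/eqP|g1 i le_in].
    by rewrite eqr_nat fix_card1 => /eqP.
  apply/eqP; rewrite eqr_nat fix_card1; apply/eqP.
  exact: (@lproj_eq_le _ d_gt0 _ n g (invlim1 G)).
have H_gt0 := cardG_gt0 (level_kernel_group G n).
rewrite (haar_gt0 hmu (saturatedS d_gt0 sA)) cond_expectation_history//.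
rewrite (lproj_image_kernel AE) => /(_ H_gt0)/eqP.
rewrite (can2_eq (divfK _) (mulfK _)) ?pnatr_eq0 -?lt0n//.
by rewrite -natr_sum -natrM eqr_nat => /eqP.
Qed.

Lemma atrans_martingale :
  (forall n (v : n.-tuple 'I_d),
    [transitive level_kernel G n, on children v | 'P]) ->
  martingale mu (fixed_point_process (G := G) R).
Proof.
move=> trH n t A; have sA : saturated n A by exact: saturated_history.
rewrite (haar_gt0 hmu (saturatedS d_gt0 sA)) cond_expectation_history// => B_gt0.
(* Of the whole history, only the value at time [n] enters the average. *)
rewrite (@sum_fix_card_saturated _ _ (t n))//; last by move=> g /(_ n (leqnn n)).
by rewrite mulfK// pnatr_eq0 -lt0n.
Qed.

End Martingale.

Theorem theorem5p7 (R : realType) (d : nat) (hd : (2 <= d)%N)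
  (G : autSubgroup d) (mu : probability (invlim_borel G) R)
  (hmu : is_haar mu) :
  martingale mu (fixed_point_process (G := G) R) <->
  (forall (n : nat) (v : n.-tuple 'I_d),
     [transitive (level_kernel G n), on (children v) | 'P]).
Proof.
have d_gt0 := ltnW hd.
by split; [exact: martingale_atrans | exact: atrans_martingale].
Qed.
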